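(* Let $\Omega\subset\mathbb{R}^n$ be a bounded domain (open and connected) with Lipschitz boundary, and let $E\subset\Omega$ be measurable with $|E|>0$. Let $Q>0$ be a constant such that $\|u-u_\Omega\|_{L^2(\Omega)}\le Q\|\nabla u\|_{L^2(\Omega)}$ for every $u\in W^{1,2}(\Omega)$, and let $K>0$ be a constant such that $\left\|\nabla u-\frac12(\nabla u-(\nabla u)^T)_\Omega\right\|_{L^2(\Omega)}\le K\|\widehat\nabla u\|_{L^2(\Omega)}$ for every $u\in W^{1,2}(\Omega;\mathbb{R}^n)$, where $\widehat\nabla u=\frac12(\nabla u+(\nabla u)^T)$. Then, for every $u\in W^{1,2}(\Omega;\mathbb{R}^n)$, $$\left\|u-u_E-\tfrac12(\nabla u-(\nabla u)^T)_E\,(x-x_E)\right\|_{W^{1,2}(\Omega)}\le\left(1+\left(2\frac{|\Omega|}{|E|}\bigl(1+(\mathrm{diam}\,\Omega)^2\bigr)\right)^{\frac12}\right)K(1+Q^2)^{\frac12}\|\widehat\nabla u\|_{L^2(\Omega)}.$$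
   Context: For a measurable set $F$ of positive measure, $f_F=\frac{1}{|F|}\int_F f$ denotes the average of $f$ over $F$ (also for vector and matrix valued $f$), $|F|$ is the Lebesgue measure, and $x_F=\frac{1}{|F|}\int_F x\,dx$ is the center of mass of $F$. The gradient convention is $(\nabla u)_{ij}=\partial_ju_i$. Norms: $\|u\|_{W^{1,2}(\Omega)}=\left(\int_\Omega |u|^2+|\nabla u|^2\right)^{1/2}$, with the Euclidean (Frobenius) norm on vectors and matrices. The constants $Q$ and $K$ exist by the classical Poincaré inequality and Korn inequality (of second kind). *)

(* Defs.v *)
From HB Require Import structures.
From mathcomp Require Import all_boot all_order all_algebra.
From mathcomp Require Import all_classical all_reals all_analysis.

Set Implicit Arguments.
Unset Strict Implicit.
Unset Printing Implicit Defensive.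

Import Order.TTheory GRing.Theory Num.Theory.
Import numFieldNormedType.Exports.

Local Open Scope classical_set_scope.
Local Open Scope ring_scope.

(** Points of R^(n+1) are column vectors, so that a matrix acts by [A *m x].
    The library norm on matrices is the sup norm; it is used only through the
    topology it induces and through [bounded_set]. *)

Definition enorm (R : realType) (m p : nat) (A : 'M[R]_(m, p)) : R :=
  Num.sqrt (\sum_i \sum_j (A i j) ^+ 2).

Definition diam (R : realType) (m : nat) (A : set 'cV[R]_m) : R :=
  sup [set r | exists x y, [/\ A x, A y & r = enorm (x - y)]].

Section lebesgue_measure_Rn.
Context (R : realType) (n : nat).
Local Notation V := 'cV[R]_n.+1.

Definition box (a b : V) : set V :=
  [set x | forall i, a i 0 < x i 0 <= b i 0].

Definition box_volume (a b : V) : R :=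
  \prod_i Num.max 0 (b i 0 - a i 0).

Definition box_cover (X : set V) : set ((V * V)^nat) :=
  [set Q | X `<=` \bigcup_k box (Q k).1 (Q k).2].

Definition lebesgue_outer (X : set V) : \bar R :=
  ereal_inf [set (\sum_(k <oo) (box_volume (Q k).1 (Q k).2)%:E)%E
            | Q in box_cover X].

Local Open Scope ereal_scope.

Let vol (q : V * V) : \bar R := (box_volume q.1 q.2)%:E.

Let vol_ge0 q : 0 <= vol q.
Proof.
by rewrite lee_fin /box_volume prodr_ge0// => i _; rewrite le_max lexx.
Qed.

Lemma lebesgue_outer_ge0 X : 0 <= lebesgue_outer X.
Proof.
by apply: le_ereal_inf_tmp => _ [Q _ <-]; apply: nneseries_ge0 => k _ _;
  exact: (vol_ge0 (Q k)).
Qed.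

Lemma lebesgue_outer0 : lebesgue_outer set0 = 0.
Proof.
apply/eqP; rewrite eq_le lebesgue_outer_ge0 andbT.
apply: ereal_inf_lbound; exists (fun=> (0%R, 0%R)) => //.
rewrite eseries0// => k _ _; rewrite /box_volume /= big_ord_recl.
by rewrite subrr Order.POrderTheory.maxxx mul0r.
Qed.

Lemma le_lebesgue_outer :
  {homo lebesgue_outer : A B / A `<=` B >-> A <= B}.
Proof.
move=> A B AB; apply/ereal_inf_le_tmp => _ [Q BQ <-].
by exists Q => //; exact: subset_trans AB BQ.
Qed.

Lemma lebesgue_outer_sigma_subadditive : sigma_subadditive lebesgue_outer.
Proof.
move=> A; have [[i ioo]|] := pselect (exists i, lebesgue_outer (A i) = +oo).
  rewrite (eseries_pinfty _ _ ioo) ?leey// => k _.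
  by rewrite -ltNye (lt_le_trans _ (lebesgue_outer_ge0 _)).
rewrite -forallNE => Aoo.
suff add2e (e : {posnum R}) : lebesgue_outer (\bigcup_n A n) <=
    \sum_(i <oo) lebesgue_outer (A i) + e%:num%:E.
  by apply/lee_addgt0Pr => _/posnumP[].
rewrite (le_trans _ (epsilon_trick _ _ _))//; last first.
  by move=> k; exact: lebesgue_outer_ge0.
pose P k (B : (V * V)^nat) := box_cover (A k) B /\
  \sum_(j <oo) vol (B j) <= lebesgue_outer (A k) + (e%:num / (2 ^ k.+1)%:R)%:E.
have [G PG] : {G : ((V * V)^nat)^nat & forall k, P k (G k)}.
  apply: (@choice _ _ P) => k; rewrite /P /lebesgue_outer.
  set S := (X in ereal_inf X); move infS : (ereal_inf S) => iS.
  case: iS infS => [r Sr|Soo|Soo].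
  - have en1 : (0 < e%:num / (2 ^ k.+1)%:R)%R by [].
    have /(lb_ereal_inf_adherent en1) : ereal_inf S \is a fin_num by rewrite Sr.
    move=> [x [B AB muBx] xS].
    by exists B; split => //; rewrite muBx -Sr; exact/ltW.
  - by have := Aoo k; rewrite /lebesgue_outer Soo.
  - suff : lbound S 0 by move/le_ereal_inf_tmp; rewrite Soo.
    move=> /= _ [B _ <-]; apply: nneseries_ge0 => j _ _.
    exact: (vol_ge0 (B j)).
have volG_ge0 x : 0 <= (vol \o uncurry G) x by exact: vol_ge0.
apply: (@le_trans _ _ (\esum_(i in setT) (vol \o uncurry G) i)).
  rewrite /lebesgue_outer; apply: ereal_inf_lbound => /=.
  have /card_esym/ppcard_eqP[f] := card_nat2.
  exists (uncurry G \o f).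
    move=> t [i _] /(PG i).1 [j _ Bijt]; exists (f^-1%FUN (i, j)) => //=.
    by rewrite invK ?inE.
  rewrite -(esum_pred_image (vol \o uncurry G) _ xpredT) ?[fun=> _]set_true//.
  by rewrite image_eq.
rewrite (_ : esum _ _ = \sum_(i <oo) \sum_(j <oo ) vol (G i j)); last first.
  pose J : nat -> set (nat * nat) := fun i => [set (i, j) | j in setT].
  rewrite (_ : setT = \bigcup_k J k); last first.
    by rewrite predeqE => -[a b]; split => // _; exists a => //; exists b.
  rewrite esum_bigcupT /=; last 2 first.
    - apply/trivIsetP => i j _ _ ij.
      rewrite predeqE => -[k m] /=; split => //= -[] [_] _ [<-{k} _].
      by move=> [m' _] [] /esym/eqP; rewrite (negbTE ij).
    - by move=> /= [k m]; exact: vol_ge0.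
  rewrite -(image_id [set: nat]) -fun_true esum_pred_image//; last first.
    by move=> k _; exact: esum_ge0.
  apply: eq_eseriesr => /= j _.
  rewrite -(esum_pred_image (vol \o uncurry G) (pair j) predT)//=; last first.
    by move=> ? ? _ _; exact: (@can_inj _ _ _ snd).
  by congr esum; rewrite predeqE => -[a b]; split; move=> [i _ <-]; exists i.
apply: lee_nneseries => k _ *; last exact: (PG k).2.
by apply: nneseries_ge0 => m *; exact: (volG_ge0 (k, m)).
Qed.

HB.instance Definition _ := isOuterMeasure.Build R V lebesgue_outer
  lebesgue_outer0 lebesgue_outer_ge0 le_lebesgue_outer
  lebesgue_outer_sigma_subadditive.

End lebesgue_measure_Rn.

(** R^(n+1) with its Lebesgue (complete) sigma-algebra: the Caratheodory
    measurable sets of the Lebesgue outer measure. *)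
Notation lebesgue_Rn R n := (caratheodory_type (@lebesgue_outer R n)).

Definition caratheodory_measure (R : realType) (T : pointedType)
    (mu : {outer_measure set T -> \bar R}) :
    {measure set (caratheodory_type mu) -> \bar R} :=
  (mu : set (caratheodory_type mu) -> \bar R).

Definition leb (R : realType) (n : nat) :
    {measure set (lebesgue_Rn R n) -> \bar R} :=
  caratheodory_measure (@lebesgue_outer R n).

Section averages.
Context (R : realType) (n : nat).
Local Notation V := (lebesgue_Rn R n).

Definition avg (F : set V) (f : V -> R) : R :=
  (fine (leb R n F))^-1 * \int[leb R n]_(x in F) f x.

Definition avg_mx (m p : nat) (F : set V) (f : V -> 'M[R]_(m, p)) :
    'M[R]_(m, p) :=
  \matrix_(i, j) avg F (fun x => f x i j).

Definition barycenter (F : set V) : 'cV[R]_n.+1 :=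
  avg_mx F (fun x : 'cV[R]_n.+1 => x).

Definition skew_avg (F : set V) (G : V -> 'M[R]_n.+1) : 'M[R]_n.+1 :=
  2^-1 *: avg_mx F (fun x => G x - (G x)^T).

Definition sym_part (A : 'M[R]_n.+1) : 'M[R]_n.+1 := 2^-1 *: (A + A^T).

End averages.

Section sobolev.
Context (R : realType) (n : nat).
Local Notation V := 'cV[R]_n.+1.

Definition partial (j : 'I_n.+1) (f : V -> R) : V -> R :=
  fun x => 'D_(delta_mx j 0) f x.

(** All iterated partial derivatives are differentiable everywhere. *)
Definition smooth (f : V -> R) : Prop :=
  forall (s : seq 'I_n.+1) (x : V), differentiable (foldr partial f s) x.

Definition test_function (Omega : set V) (phi : V -> R) : Prop :=
  let supp := closure [set x | phi x != 0] in
  [/\ smooth phi, compact supp & supp `<=` Omega].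

Definition weak_partial (Omega : set V) (j : 'I_n.+1) (f g : V -> R) : Prop :=
  forall phi, test_function Omega phi ->
    \int[leb R n]_(x in Omega) (f x * partial j phi x) =
    - \int[leb R n]_(x in Omega) (g x * phi x).

Definition L2 (Omega : set V) (f : V -> R) : Prop :=
  (f \_ Omega : lebesgue_Rn R n -> R) \in Lfun (leb R n) 2%:E.

(** [W12 Omega f g]: f belongs to W^{1,2}(Omega) and g is (a representative of)
    its weak gradient, which is unique almost everywhere. *)
Definition W12 (Omega : set V) (f : V -> R) (g : V -> 'rV[R]_n.+1) : Prop :=
  L2 Omega f /\
  forall j, L2 Omega (fun x => g x 0 j) /\
            weak_partial Omega j f (fun x => g x 0 j).

(** Vector-valued version, with [Du x i j] the j-th weak partial derivative of
    the i-th component of u. *)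
Definition W12_vec (Omega : set V) (u : V -> V) (Du : V -> 'M[R]_n.+1) : Prop :=
  forall i, W12 Omega (fun x => u x i 0) (fun x => row i (Du x)).

(** Norms are extended-real valued, hence never finite by convention. *)
Definition L2norm (Omega : set V) (f : V -> R) : \bar R :=
  'N[leb R n]_(2%:E)[EFin \o (f \_ Omega : lebesgue_Rn R n -> R)]%E.

Definition L2norm_mx (m p : nat) (Omega : set V) (F : V -> 'M[R]_(m, p)) :
    \bar R :=
  L2norm Omega (fun x => enorm (F x)).

Definition W12norm (Omega : set V) (u : V -> V) (Du : V -> 'M[R]_n.+1) :
    \bar R :=
  ((\int[leb R n]_(x in Omega) (enorm (u x) ^+ 2 + enorm (Du x) ^+ 2)%:E)
    `^ 2^-1)%E.

(** Near each boundary point, after an orthogonal change of coordinates,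
    Omega is the set of points lying strictly above the graph of a Lipschitz
    function of the first n coordinates. *)
Definition lipschitz_boundary (Omega : set V) : Prop :=
  forall p : V, closure Omega p -> ~ interior Omega p ->
  exists (r L : R) (O : 'M[R]_n.+1) (gamma : 'cV[R]_n -> R),
    [/\ 0 < r, O *m O^T = 1%:M,
        (forall s t, `|gamma s - gamma t| <= L * enorm (s - t)) &
        forall x : V, enorm (x - p) < r ->
          let y := O *m x in
          Omega x <-> gamma (row' ord_max y) < y ord_max 0].

End sobolev.

(* Main.v *)
Require Import Defs.
From HB Require Import structures.
From mathcomp Require Import all_boot all_order all_algebra.
From mathcomp Require Import all_classical all_reals all_analysis.
From mathcomp Require Import measurable_realfun ring lra.

Set Implicit Arguments.
Unset Strict Implicit.
Unset Printing Implicit Defensive.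

Import Order.TTheory GRing.Theory Num.Theory.
Import numFieldNormedType.Exports.

Local Open Scope classical_set_scope.
Local Open Scope ring_scope.

(** Korn gives [|Du - A| <= K |sym Du|] in [L^2], with [A] the averaged
    skew part over [Omega]; Poincare applied to the components of [u - A x]
    then bounds the full [W^{1,2}] norm of [v = u - A x - c]. Replacing [u] by
    [v] does not change the left-hand side, since the normalisation over [E]
    kills affine maps with skew gradient. Finally [v] minus its normalisation
    differs from [v] by the affine map [v_E + S (x - x_E)], whose [W^{1,2}]
    norm is controlled by Jensen's inequality on [E].

    That affine maps belong to [W^{1,2}] rests on [\int d_j f = 0] for compactly
    supported C^1 functions [f]. It is obtained without Fubini: the integral of
    a difference quotient vanishes by translation invariance, and dominated
    convergence passes to the limit. *)

(** * The Lebesgue outer measure: measurability of open sets and translation invariance *)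

Section lebesgue_sets.
Context (R : realType) (n : nat).
Local Notation V := 'cV[R]_n.+1.
Local Notation mu := (@lebesgue_outer R n).

Lemma box_volume_ge0 (a b : V) : 0 <= box_volume a b.
Proof. by apply: prodr_ge0 => i _; rewrite le_max lexx. Qed.

Lemma lebesgue_outer_box (a b : V) : (mu (box a b) <= (box_volume a b)%:E)%E.
Proof.
(* The single box is padded with the degenerate box from 0 to 0, whose volume vanishes because there
   is at least one coordinate. *)
pose Q k : V * V := if k is 0%N then (a, b) else (0, 0).
have vol0 : box_volume (0 : V) 0 = 0.
  by rewrite /box_volume big_ord_recl subrr Order.POrderTheory.maxxx mul0r.
apply: ereal_inf_lbound; exists Q; first by move=> x abx; exists 0%N.
rewrite (nneseries_split 0%N 1%N); last first.
  by move=> k _; rewrite lee_fin box_volume_ge0.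
rewrite add0n big_nat1 /= eseries0 ?adde0//.
by case=> // k _ _; rewrite /Q /= vol0.
Qed.

Definition set_coord (i : 'I_n.+1) (r : R) (a : V) : V :=
  \col_k (if k == i then r else a k 0).

(** Cutting along the hyperplane where coordinate [i] equals [c] only changes the side in direction
    [i]. Truncating side lengths at 0 keeps the identity exact when the hyperplane misses the box or
    the box is empty. *)
Lemma box_volume_split (i : 'I_n.+1) (c : R) (a b : V) :
  box_volume a (set_coord i (Num.min (b i 0) c) b) +
  box_volume (set_coord i (Num.max (a i 0) c) a) b = box_volume a b.
Proof.
rewrite /box_volume [X in X + _](bigD1 i)//= [X in _ + X](bigD1 i)//=.
rewrite [RHS](bigD1 i)//= !mxE eqxx.
rewrite [X in _ * X + _](eq_bigr (fun k => Num.max 0 (b k 0 - a k 0))); last first.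
  by move=> k /negbTE ki; rewrite mxE ki.
rewrite [X in _ + _ * X](eq_bigr (fun k => Num.max 0 (b k 0 - a k 0))); last first.
  by move=> k /negbTE ki; rewrite mxE ki.
rewrite -mulrDl; congr (_ * _).
move: (a i 0) (b i 0) => p q; have [qc|cq] := leP q c; have [pc|cp] := leP p c;
  (do 3 try (case: (leP 0 (_ - _)) => ?)); lra.
Qed.

(** Every cover of [X] is cut by the hyperplane into a cover of each of the two pieces of [X], with
    no change of total volume. Half-open boxes stay half-open under this cut. *)
Lemma halfspace_caratheodory (i : 'I_n.+1) (c : R) :
  mu.-caratheodory [set x : V | x i 0 <= c].
Proof.
apply: le_caratheodory_measurable => X.
apply: le_ereal_inf_tmp => _ [Q XQ <-].
rewrite -(eq_eseriesr (fun k _ => congr1 EFin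
  (box_volume_split i c (Q k).1 (Q k).2))).
rewrite (eq_eseriesr (fun k _ => EFinD _ _)).
rewrite nneseriesD; [|by move=> k _ _; rewrite lee_fin box_volume_ge0..].
apply: leeD; apply: ereal_inf_lbound.
- exists (fun k => ((Q k).1, set_coord i (Num.min ((Q k).2 i 0) c) (Q k).2)) => //.
  move=> x [/XQ[k _ Qkx] xc]; exists k => //= j.
  have /andP[ax xb] := Qkx j; rewrite mxE ax /=; case: eqVneq => [ji|//].
  by rewrite -ji le_min xb /= ji.
- exists (fun k => (set_coord i (Num.max ((Q k).1 i 0) c) (Q k).1, (Q k).2)) => //.
  move=> x [/XQ[k _ Qkx] /= /negP]; rewrite -ltNge => xc; exists k => //= j.
  have /andP[ax xb] := Qkx j; rewrite mxE xb andbT; case: eqVneq => [ji|//].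
  by rewrite -ji gt_max ax /= ji.
Qed.

Lemma measurable_box (a b : V) : measurable (box a b : set (lebesgue_Rn R n)).
Proof.
rewrite (_ : box a b = \bigcap_(i in [set: 'I_n.+1])
    ([set x | x i 0 <= b i 0] `\` [set x | x i 0 <= a i 0])); last first.
  apply/seteqP; split => x /=.
    by move=> abx i _ /=; have /andP[? ?] := abx i; split=> //; apply/negP; rewrite -ltNge.
  by move=> abx i; have [/= -> /negP] := abx i I; rewrite -ltNge => ->.
apply: (@fin_bigcap_measurable _ (lebesgue_Rn R n)) => // i _.
by apply: (@measurableD _ (lebesgue_Rn R n)); exact: halfspace_caratheodory.
Qed.

(** An open set is the union of the half-open grid cubes of side [1 / (k + 1)] that it contains,
    over all [k]. These cubes are countably many, and [pickle] enumerates them. *)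
Lemma open_measurable_Rn (U : set V) :
  open U -> measurable (U : set (lebesgue_Rn R n)).
Proof.
move=> oU.
pose grid (p : {ffun 'I_n.+1 -> int} * nat) : set V :=
  box (\col_i ((p.1 i)%:~R / p.2.+1%:R)) (\col_i ((p.1 i + 1)%:~R / p.2.+1%:R)).
pose G (m : nat) : set V := if unpickle m is Some p then
  (if `[< grid p `<=` U >] then grid p else set0) else set0.
rewrite (_ : U = \bigcup_m G m); last first.
  apply/seteqP; split => x; last first.
    by case=> m _; rewrite /G; case: unpickle => // p; case: asboolP => // + ?; exact.
  move=> Ux; have /nbhs_ballP[e /= e0 eU] : nbhs x U by exact: open_nbhs_nbhs.
  pose k := Num.bound e^-1.
  have ke : k.+1%:R^-1 < e.
    rewrite invf_plt ?posrE// (lt_trans (archi_boundP _)) ?invr_ge0 1?ltW//.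
    by rewrite ltr_nat.
  (* The cubes are open on the left and closed on the right, so the lower corner is the ceiling
     minus one rather than the floor. *)
  pose z : {ffun 'I_n.+1 -> int} := [ffun i => Num.ceil (x i 0 * k.+1%:R) - 1].
  have zx i : (z i)%:~R / k.+1%:R < x i 0 <= (z i + 1)%:~R / k.+1%:R.
    rewrite ltr_pdivrMr// ler_pdivlMr// /z ffunE subrK ceil_ge andbT.
    by have /andP[] := ceil_itv (x i 0 * k.+1%:R).
  exists (pickle (z, k)) => //; rewrite /G pickleK.
  case: asboolP => [_ i|]; first by rewrite !mxE.
  case => y zy; apply: eU => /=; split => // i j; rewrite ord1.
  have := zy i; rewrite !mxE /= /ball /= => /andP[yl yr].
  have /andP[xl xr] := zx i; apply: le_lt_trans ke.
  have : (z i + 1)%:~R / k.+1%:R = (z i)%:~R / k.+1%:R + k.+1%:R^-1 :> R.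
    by rewrite intrD mulrDl mul1r.
  set p := _ / _ in yr xr *; set q := _ / _ in yl xl *; set r := _^-1 => pqr.
  by rewrite ler_norml; lra.
apply: (@bigcupT_measurable _ (lebesgue_Rn R n)) => m; rewrite /G.
case: unpickle => [p|]; last exact: (@measurable0 _ (lebesgue_Rn R n)).
by case: asboolP => _; [exact: measurable_box|exact: (@measurable0 _ (lebesgue_Rn R n))].
Qed.

Lemma continuous_measurable_Rn (f : V -> R) :
  continuous f -> measurable_fun [set: lebesgue_Rn R n] (f : lebesgue_Rn R n -> R).
Proof.
move=> cf; apply: (measurability _ (RGenOInfty.measurableE R)) => //.
move=> _ [_ [a ->] <-]; rewrite setTI; apply: open_measurable_Rn.
by apply: open_comp => //; exact: rray_open.
Qed.

Lemma bounded_sub_box (A : set V) : bounded_set A ->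
  exists2 M : R, 0 < M & A `<=` box (const_mx (- M)) (const_mx M).
Proof.
move=> [M [_ AM]]; exists (`|M| + 2); first by rewrite ltr_wpDl.
move=> x /(AM (`|M| + 1)); rewrite (le_lt_trans (ler_norm _)) ?ltrDl// => /(_ isT) xM i.
rewrite !mxE.
have : `|x i 0| <= `|M| + 1 by apply: le_trans xM; rewrite /Num.norm/= mx_normrE;
  exact: (le_bigmax _ (fun ij => `|x ij.1 ij.2|) (i, 0)).
by rewrite ler_norml; lra.
Qed.

Lemma bounded_leb_lty (A : set V) : bounded_set A -> (mu A < +oo)%E.
Proof.
move=> /bounded_sub_box[M _ /le_lebesgue_outer/le_lt_trans]; apply.
exact: le_lt_trans (lebesgue_outer_box _ _) (ltry _).
Qed.

Lemma lebesgue_outer_translate_le (h : V) (A : set V) :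
  (mu [set x | A (x + h)%R] <= mu A)%E.
Proof.
apply: le_ereal_inf_tmp => _ [Q AQ <-].
apply: ereal_inf_lbound; exists (fun k => ((Q k).1 - h, (Q k).2 - h)).
  move=> x /AQ[k _ Qkx]; exists k => //= i.
  by have := Qkx i; rewrite !mxE ltrBlDr lerBrDr.
apply: eq_eseriesr => k _ /=; congr EFin; apply: eq_bigr => i _.
by rewrite !mxE opprB addrA subrK.
Qed.

Lemma lebesgue_outer_translate (h : V) (A : set V) :
  mu [set x | A (x + h)] = mu A.
Proof.
apply/eqP; rewrite eq_le lebesgue_outer_translate_le /=.
have := lebesgue_outer_translate_le (- h) [set x | A (x + h)].
rewrite (_ : [set x | [set x | A (x + h)] (x - h)] = A)//.
by apply/seteqP; split => x /=; rewrite subrK.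
Qed.

(** Measurability is the Caratheodory splitting condition. Splitting [X] by the translate of [A]
    amounts to splitting the shifted set [Y] by [A], because the outer measure is translation
    invariant. *)
Lemma measurable_translate (h : V) :
  measurable_fun [set: lebesgue_Rn R n]
    ((fun x : V => x + h) : lebesgue_Rn R n -> lebesgue_Rn R n).
Proof.
move=> _ A mA; rewrite setTI.
change (mu.-caratheodory A) in mA; change (mu.-caratheodory [set x : V | A (x + h)]).
move=> X.
pose Y := [set x : V | X (x - h)].
have YX (B : set V) : [set x | (Y `&` B) (x + h)] = X `&` [set x | B (x + h)].
  by apply/seteqP; split => x /=; rewrite /Y /= addrK.
rewrite -(lebesgue_outer_translate (- h) X) -/Y (mA Y).
by rewrite -(lebesgue_outer_translate h (Y `&` A))
  -(lebesgue_outer_translate h (Y `&` ~` A)) !YX.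
Qed.

Local Notation T := (lebesgue_Rn R n).

Lemma integrable_translate (h : V) (f : V -> R) :
  (leb R n).-integrable setT (EFin \o f : T -> \bar R) ->
  (leb R n).-integrable setT (EFin \o (fun x : V => f (x + h)) : T -> \bar R).
Proof.
move=> /integrableP[mf fy]; apply/integrableP; split.
  exact: (measurableT_comp mf (measurable_translate h)).
have mg : measurable_fun [set: T] (fun x : T => `|(f x)%:E|%E) by exact: measurableT_comp.
have := @ge0_integral_pushforward _ _ T T R _ (measurable_translate h) (leb R n)
  setT (fun x => `|(f x)%:E|%E) measurableT mg (fun x _ => abse_ge0 _).
rewrite preimage_setT => <-.
apply: le_lt_trans fy; rewrite le_eqVlt; apply/predU1P; left.
apply: eq_measure_integral; first exact: measurable_translate.
by move=> mt A mA _; exact: (lebesgue_outer_translate h A).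
Qed.

(** Change of variables: the push-forward of the measure under a translation is the measure
    itself. *)
Lemma Rintegral_translate (h : V) (f : V -> R) :
  (leb R n).-integrable setT (EFin \o f : T -> \bar R) ->
  \int[leb R n]_x f (x + h)%R = \int[leb R n]_x f x.
Proof.
move=> intf; have [mf _] := integrableP _ _ _ intf; congr fine.
have := @integral_pushforward _ _ T T R _ (measurable_translate h) (leb R n)
  setT (EFin \o f) mf (integrable_translate h intf) measurableT.
rewrite preimage_setT => <-.
apply: eq_measure_integral; first exact: measurable_translate.
by move=> mt A mA _; exact: (lebesgue_outer_translate h A).
Qed.

End lebesgue_sets.

(** * Integrals of partial derivatives of compactly supported functions *)

Section compact_support.
Context (R : realType) (n : nat).
Local Notation V := 'cV[R]_n.+1.
Local Notation T := (lebesgue_Rn R n).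
Local Notation mu := (leb R n).

Lemma continuous_compact_support_bounded (f : V -> R) (C : set V) :
  continuous f -> compact C -> (forall x, ~ C x -> f x = 0) ->
  exists2 M, 0 < M & forall x, `|f x| <= M.
Proof.
move=> cf cC f0.
have [M [_ /(_ (`|M| + 1))]] : bounded_set (f @` C).
  by apply/compact_bounded/continuous_compact => //; exact: continuous_subspaceT.
rewrite (le_lt_trans (ler_norm _)) ?ltrDl// => /(_ isT) fM.
exists (`|M| + 1); first by rewrite ltr_wpDl.
move=> x; have [Cx|/f0->] := pselect (C x); first by apply: fM; exists x.
by rewrite normr0 addr_ge0.
Qed.

Lemma compact_measurable_Rn (C : set V) : compact C -> measurable (C : set T).
Proof.
move=> cC; rewrite -(setCK C); apply: (@measurableC _ T).
exact/open_measurable_Rn/closed_openC/(compact_closed (@norm_hausdorff _ _)).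
Qed.

Lemma continuous_compact_support_integrable (f : V -> R) (C : set V) :
  continuous f -> compact C -> (forall x, ~ C x -> f x = 0) ->
  mu.-integrable setT (EFin \o f : T -> \bar R).
Proof.
move=> cf cC f0; have mC := compact_measurable_Rn cC.
have [M M0 fM] := continuous_compact_support_bounded cf cC f0.
rewrite (_ : EFin \o f = (EFin \o f) \_ C); last first.
  apply/funext => x; rewrite /patch; case: ifPn => // /negP xC /=.
  by rewrite f0// => Cx; apply: xC; rewrite inE.
apply/(@integrable_mkcond _ T _ mu C (EFin \o f)) => //.
apply: (@measurable_bounded_integrable _ T R mu f C mC) => //.
- exact/bounded_leb_lty/compact_bounded.
- exact/measurable_funTS/continuous_measurable_Rn.
- exists M; split; first exact: gtr0_real.
  by move=> y My x _; exact: le_trans (fM x) (ltW My).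
Qed.

Lemma partial_eq0_outside (f : V -> R) (C : set V) (j : 'I_n.+1) (x : V) :
  closed C -> (forall x, ~ C x -> f x = 0) -> ~ C x -> partial j f x = 0.
Proof.
move=> cC f0 Cx; rewrite /partial (@near_eq_derive _ _ _ _ (cst 0)).
- exact: derive_cst.
- have : nbhs x (~` C) by apply: open_nbhs_nbhs; split=> //; exact: closed_openC.
  by apply: filterS => y /f0 ->.
Qed.

(** Mean value theorem along a coordinate line. It bounds all difference quotients by a global bound
    on the partial derivative, so the location of [c] is left unrecorded. *)
Lemma partial_mean_value (f : V -> R) (j : 'I_n.+1) (x : V) (h : R) :
  (forall x, differentiable f x) -> 0 < h ->
  exists c, f (x + h *: delta_mx j 0) - f x =
            partial j f (x + c *: delta_mx j 0) * h.
Proof.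
move=> df h0; set v : V := delta_mx j 0.
have dg (t : R) : is_derive t 1 (fun t => f (x + t *: v)) (partial j f (x + t *: v)).
  have growthE : (fun h0 => h0^-1 *: (((fun t => f (x + t *: v)) \o shift t) (h0 *: 1) -
      f (x + t *: v))) =
      (fun h0 => h0^-1 *: ((f \o shift (x + t *: v)) (h0 *: v) - f (x + t *: v))).
    apply/funext => e /=; congr (_ *: (f _ - _)).
    by rewrite scalerDl addrCA [e *: 1]mulr1.
  apply: DeriveDef; first by rewrite /derivable growthE; exact: diff_derivable.
  by rewrite /derive growthE.
have cg : continuous (fun t : R => f (x + t *: v)).
  by move=> t; apply/differentiable_continuous/derivable1_diffP; case: (dg t).
have [c _] := MVT h0 (fun t _ => dg t) (continuous_subspaceT cg).
by rewrite scale0r addr0 subr0 => ->; exists c.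
Qed.

Lemma partial_difference_quotient_cvg (f : V -> R) (j : 'I_n.+1) (x : V) :
  differentiable f x ->
  (fun k => k.+1%:R * (f (x + k.+1%:R^-1 *: delta_mx j 0) - f x)) @ \oo
    --> partial j f x.
Proof.
move=> df; have /cvg_ex[l fl] := @diff_derivable _ _ _ f x (delta_mx j 0) df.
rewrite /partial /derive (cvg_lim _ fl)//.
(* The derivative is a limit over punctured neighbourhoods, so the steps must tend to 0 through
   nonzero values. *)
have h0 : @harmonic R @ \oo --> 0^'.
  move=> A A0; have : \forall k \near \oo, @harmonic R k != 0 -> A (harmonic k) :=
    cvg_harmonic A0.
  change ((\forall k \near \oo, @harmonic R k != 0 -> A (harmonic k)) ->
          \forall k \near \oo, A (@harmonic R k)).
  by apply: filterS => k; apply; rewrite gt_eqF// harmonic_gt0.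
have := cvg_comp _ _ h0 fl; apply: cvg_trans; apply: near_eq_cvg; near=> k.
by rewrite /= invrK [x + _]addrC.
Unshelve. all: by end_near. Qed.

Lemma Rintegral_partial_eq0 (f : V -> R) (C : set V) (j : 'I_n.+1) :
  (forall x, differentiable f x) -> continuous (partial j f) ->
  compact C -> (forall x, ~ C x -> f x = 0) ->
  \int[mu]_x partial j f x = 0.
Proof.
move=> df cdf cC f0.
have clC : closed C := compact_closed (@norm_hausdorff _ _) cC.
have cf : continuous f by move=> x; exact: differentiable_continuous.
have intf := continuous_compact_support_integrable cf cC f0.
have [M M0 dfM] := continuous_compact_support_bounded cdf cC
  (fun x => partial_eq0_outside j clC f0).
have [N N0 CN] := bounded_sub_box (compact_bounded cC).
(* The steps [h k] are at most 1, so enlarging the box around [C] by 1 on each side captures the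
   supports of all the difference quotients. [M] times the indicator of [B] is then the dominating
   function. *)
pose B : set V := box (const_mx (- N - 1)) (const_mx (N + 1)).
pose h k : R := k.+1%:R^-1.
have h0 k : 0 < h k by rewrite invr_gt0.
pose q k (x : V) : R := k.+1%:R * (f (x + h k *: delta_mx j 0) - f x).
have intfh k := integrable_translate (h k *: delta_mx j 0) intf.
have intq k : mu.-integrable setT (EFin \o q k : T -> \bar R).
  apply: eq_integrable (integrableZl measurableT k.+1%:R (integrableB measurableT (intfh k) intf)) => //.
have q0 k : \int[mu]_x q k x = 0.
  rewrite RintegralZl//=; last first.
    exact: (integrableB measurableT (intfh k) intf).
  by rewrite RintegralB// Rintegral_translate// subrr mulr0.
have qM k x : `|q k x| <= M * \1_B x.
  rewrite indicE; case: (boolP (x \in B)) => xB.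
    rewrite mulr1 /q; have [c ->] := partial_mean_value j x df (h0 k).
    by rewrite mulrCA /h mulfV// mulr1.
  rewrite mulr0 /q !f0 ?subrr ?mulr0 ?normr0//.
    by move/CN => xN; move/negP: xB; apply; rewrite inE => i; have := xN i; rewrite !mxE; lra.
  move/CN => xN; move/negP: xB; apply; rewrite inE => i; have := xN i; rewrite !mxE.
  have : 0 <= h k * ((i == j) && (0 == 0 :> 'I_1))%:R <= 1.
    by rewrite mulr_ge0 ?(ltW (h0 k))//= mulr_ile1 ?(ltW (h0 k))// ?lern1 ?leq_b1// invf_le1// ler1n.
  by lra.
have intM : mu.-integrable setT (fun x : T => (M * \1_B x)%:E).
  have intB : mu.-integrable setT (EFin \o \1_B : T -> \bar R).
    have mB : measurable (B : set T) := measurable_box _ _.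
    apply/integrableP; split; first exact/measurable_EFinP/measurable_indic.
    rewrite (eq_integral (fun x : T => (\1_B x)%:E)); last first.
      by move=> t _; rewrite gee0_abs// lee_fin.
    rewrite integral_indic// setIT.
    exact: le_lt_trans (lebesgue_outer_box _ _) (ltry _).
  exact: (integrableZl measurableT M intB).
have [] := @dominated_convergence _ T R mu setT measurableT (fun k => EFin \o q k) (EFin \o partial j f)
  (fun x => (M * \1_B x)%:E).
- by move=> k; have /integrableP[] := intq k.
- exact/measurable_EFinP/continuous_measurable_Rn.
- apply: aeW => x _; apply: cvg_EFin; first exact: nearW.
  exact: partial_difference_quotient_cvg.
- exact: intM.
- by apply: aeW => x k _; rewrite lee_fin qM.
move=> _ _ cvgq.
have q0e k : (\int[mu]_x (EFin \o q k) x)%E = 0%E.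
  by rewrite -(fineK (integrable_fin_num measurableT (intq k))) [fine _]q0.
rewrite /Rintegral -(cvg_lim _ cvgq)//.
by rewrite (_ : [sequence _]_ _ = cst 0%E) ?lim_cst//; apply/funext => k; exact: q0e.
Qed.

End compact_support.

(** * Square-integrable functions on a set of finite measure *)

Section square_integrable.
Context (d : measure_display) (T : measurableType d) (R : realType).
Context (mu : {measure set T -> \bar R}) (D : set T).
Hypotheses (mD : measurable D) (finD : (mu D < +oo)%E).

(** Stated through the real square, so that linearity of [Rintegral] applies without extended-real
    powers; [L2P] below identifies it with [L2]. *)
Definition sq_integrable (f : T -> R) : Prop :=
  measurable_fun D f /\ mu.-integrable D (EFin \o (fun x => f x ^+ 2)).

Lemma integrable_cst_fin (c : R) : mu.-integrable D (EFin \o (fun=> c)).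
Proof.
apply: measurable_bounded_integrable => //.
by exists `|c|; split => // y cy x _; exact: ltW.
Qed.

Lemma Rintegral_sum (I : finType) (F : I -> T -> R) :
  (forall i, mu.-integrable D (EFin \o F i)) ->
  mu.-integrable D (EFin \o (fun x => \sum_i F i x)) /\
  \int[mu]_(x in D) (\sum_i F i x) = \sum_i \int[mu]_(x in D) F i x.
Proof.
move=> iF; elim: (index_enum I) => [|i s [IHi IHe]].
  rewrite big_nil; split.
    by apply: eq_integrable (integrable_cst_fin 0) => // x _ /=; rewrite big_nil.
  under eq_Rintegral do rewrite big_nil.
  by rewrite Rintegral_cst// mul0r.
rewrite big_cons -IHe -RintegralD//; split.
  apply: eq_integrable (integrableD mD (iF i) IHi) => // x _ /=.
  by rewrite big_cons.
by apply: eq_Rintegral => x _; rewrite big_cons.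
Qed.

(** The product is dominated by [f ^+ 2 + g ^+ 2]. *)
Lemma sq_integrableM (f g : T -> R) : sq_integrable f -> sq_integrable g ->
  mu.-integrable D (EFin \o (fun x => f x * g x)).
Proof.
move=> [mf f2] [mg g2]; apply: le_integrable (integrableD mD f2 g2) => //.
  exact/measurable_EFinP/measurable_funM.
move=> x _; rewrite /= lee_fin [leRHS]ger0_norm ?addr_ge0 ?sqr_ge0//.
by rewrite ler_norml; have := sqr_ge0 (f x - g x); have := sqr_ge0 (f x + g x); nra.
Qed.

Lemma sq_integrable_bounded (f : T -> R) (M : R) : measurable_fun D f ->
  (forall x, D x -> `|f x| <= M) -> sq_integrable f.
Proof.
move=> mf fM; split => //; apply: measurable_bounded_integrable => //.
  exact: measurable_funX.
exists (M ^+ 2); split; first exact: num_real.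
move=> y My x Dx; apply: le_trans (ltW My); rewrite normrX.
by rewrite lerXn2r ?nnegrE ?fM ?(le_trans _ (fM _ Dx)).
Qed.

Lemma sq_integrable_cst (c : R) : sq_integrable (fun=> c).
Proof. exact: (@sq_integrable_bounded _ `|c|). Qed.

Lemma sq_integrable_integrable (f : T -> R) : sq_integrable f ->
  mu.-integrable D (EFin \o f).
Proof.
move=> f2; apply: eq_integrable (sq_integrableM f2 (sq_integrable_cst 1)) => //.
by move=> x _ /=; rewrite mulr1.
Qed.

Lemma sq_integrableD (f g : T -> R) : sq_integrable f -> sq_integrable g ->
  sq_integrable (fun x => f x + g x).
Proof.
move=> sf sg; have fg := sq_integrableM sf sg; move: sf sg => [mf f2] [mg g2].
split; first exact: measurable_funD.
apply: eq_integrable (integrableD mD (integrableD mD f2 g2)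
  (integrableZl mD 2 fg)) => // x _ /=; congr EFin; ring.
Qed.

Lemma sq_integrableZ (c : R) (f : T -> R) : sq_integrable f ->
  sq_integrable (fun x => c * f x).
Proof.
move=> [mf f2]; split; first exact: measurable_funM.
apply: eq_integrable (integrableZl mD (c ^+ 2) f2) => // x _ /=.
by congr EFin; ring.
Qed.

Lemma sq_integrableB (f g : T -> R) : sq_integrable f -> sq_integrable g ->
  sq_integrable (fun x => f x - g x).
Proof.
move=> sf sg; have := sq_integrableD sf (sq_integrableZ (-1) sg).
by congr sq_integrable; apply/funext => x; rewrite mulN1r.
Qed.

(** Jensen's inequality for the square: expand the nonnegative integral of [(f x - a) ^+ 2], where
    [a] is the mean of [f]. *)
Lemma sq_Rintegral_le (f : T -> R) : 0 < fine (mu D) -> sq_integrable f ->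
  fine (mu D) * ((fine (mu D))^-1 * \int[mu]_(x in D) f x) ^+ 2 <=
  \int[mu]_(x in D) (f x ^+ 2).
Proof.
move=> D0 sf; have [_ f2] := sf; have f1 := sq_integrable_integrable sf.
set a := _ * Rintegral _ _ _.
have aE : \int[mu]_(x in D) f x = fine (mu D) * a by rewrite mulVKf ?gt_eqF.
have i2 : mu.-integrable D (EFin \o (fun x => 2 * a * f x)).
  exact: (integrableZl mD (2 * a) f1).
have i3 := integrableB mD f2 i2.
have : 0 <= \int[mu]_(x in D) (f x ^+ 2 - 2 * a * f x + a ^+ 2).
  by apply: Rintegral_ge0 => x _; rewrite (_ : _ + _ = (f x - a) ^+ 2) ?sqr_ge0//; ring.
rewrite RintegralD//; last exact: integrable_cst_fin.
rewrite RintegralB// RintegralZl// Rintegral_cst// aE; lra.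
Qed.

End square_integrable.

Lemma sq_integrableS (d : measure_display) (T : measurableType d) (R : realType)
    (mu : {measure set T -> \bar R}) (D E : set T) (f : T -> R) :
  measurable D -> measurable E -> E `<=` D ->
  sq_integrable mu D f -> sq_integrable mu E f.
Proof.
move=> mD mE ED [mf f2]; split; first exact: measurable_funS mf.
exact: integrableS f2.
Qed.

(** * Stability of [W12] under addition of affine functions *)

Section sobolev_affine.
Context (R : realType) (n : nat) (Omega : set 'cV[R]_n.+1).
Hypotheses (Omega_open : open Omega) (Omega_bounded : bounded_set Omega).
Local Notation V := 'cV[R]_n.+1.
Local Notation T := (lebesgue_Rn R n).
Local Notation mu := (leb R n).

Let mO : measurable (Omega : set T) := open_measurable_Rn Omega_open.
Let finO : (mu Omega < +oo)%E := bounded_leb_lty Omega_bounded.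

Lemma L2P (f : V -> R) : L2 Omega f <-> sq_integrable mu (Omega : set T) f.
Proof.
have sqE : (fun x : T => (f \_ Omega) x ^+ 2) = (fun x => f x ^+ 2) \_ Omega.
  by apply/funext => x; rewrite /patch; case: ifP => // _; rewrite expr0n.
split => [Lf|[mf f2]].
  have := Lfun2_integrable_sqr Lf; rewrite sqE -restrict_EFin => f2.
  split; last exact/integrable_mkcond.
  by apply/(measurable_restrictT _ _) => //; move: Lf; rewrite /L2 inE => /andP[/[!inE]].
rewrite /L2 inE; apply/andP; split; rewrite ?inE /=.
  exact: (measurable_restrictT (T1 := T) f mO).1.
rewrite /finite_norm Lnorm.unlock; apply: poweR_lty.
have [_] := integrableP _ _ _ ((integrable_mkcond _ mO).1 f2); apply: le_lt_trans.
rewrite le_eqVlt; apply/orP; left; apply/eqP; apply: eq_integral => x _.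
(* Outside [Omega] the restriction takes the default value [point], which is 0 for the reals. *)
rewrite /= /patch; case: (x \in _) => /=; last by rewrite [point]/(0 : R) normr0 powR0.
by rewrite powR_mulrn// -normrX.
Qed.

Definition affine (c : R) (s : 'rV[R]_n.+1) (x : V) : R := c + (s *m x) 0 0.

Lemma differentiable_affine (c : R) (s : 'rV[R]_n.+1) (x : V) :
  differentiable (affine c s) x.
Proof.
rewrite (_ : affine c s = cst c + \sum_k (fun y : V => s 0 k *: y k 0)); last first.
  by apply/funext => y; rewrite /affine mxE fct_sumE.
apply: differentiableD => //; apply: differentiable_sum => k.
by apply: differentiableZ; exact: differentiable_coord.
Qed.

Lemma continuous_affine (c : R) (s : 'rV[R]_n.+1) : continuous (affine c s).
Proof. by move=> x; apply/differentiable_continuous/differentiable_affine. Qed.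

Lemma partial_affine (c : R) (s : 'rV[R]_n.+1) (j : 'I_n.+1) (x : V) :
  partial j (affine c s) x = s 0 j.
Proof.
apply: cvg_lim => //; apply: cvg_near_cst; near=> h.
have h0 : h != 0 by near: h; exact: nbhs_dnbhs_neq.
rewrite /= /affine mulmxDr -scalemxAr -colE !mxE.
rewrite (_ : _ - _ = h * s 0 j); last by ring.
by rewrite [_ *: _]mulrA mulVf ?mul1r.
Unshelve. all: by end_near. Qed.

Lemma L2_affine (c : R) (s : 'rV[R]_n.+1) : L2 Omega (affine c s).
Proof.
apply/L2P.
have [N N0 ON] := bounded_sub_box Omega_bounded.
apply: (@sq_integrable_bounded _ T _ _ _ _ _ _ (`|c| + \sum_k `|s 0 k| * N)) => //.
  exact/measurable_funTS/continuous_measurable_Rn/continuous_affine.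
move=> x Ox; rewrite /affine (le_trans (ler_normD _ _))// lerD2l mxE.
rewrite (le_trans (ler_norm_sum _ _ _))//; apply: ler_sum => k _.
rewrite normrM ler_wpM2l// ler_norml; have := ON _ Ox k; rewrite !mxE; lra.
Qed.

Lemma eq0_outside_support (phi : V -> R) (x : V) :
  ~ closure [set x | phi x != 0] x -> phi x = 0.
Proof. by apply: contra_notP => /eqP phix; exact: subset_closure. Qed.

(** By the product rule the claim says that the integral of the partial derivative of [psi * phi]
    vanishes, and this product is a C^1 function that is zero off the compact support of [phi]. *)
Lemma weak_partial_affine (c : R) (s : 'rV[R]_n.+1) (j : 'I_n.+1) :
  weak_partial Omega j (affine c s) (fun=> s 0 j).
Proof.
move=> phi [sphi cphi phiO]; set C := closure _ in cphi phiO.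
have clC : closed C := compact_closed (@norm_hausdorff _ _) cphi.
have dphi x : differentiable phi x := sphi [::] x.
have dphi' x : differentiable (partial j phi) x := sphi [:: j] x.
have phi0 x : ~ C x -> phi x = 0 := @eq0_outside_support phi x.
have phi0' x : ~ C x -> partial j phi x = 0 by exact: partial_eq0_outside.
have cphi0 : continuous phi by move=> x; exact: differentiable_continuous.
have cphi1 : continuous (partial j phi) by move=> x; exact: differentiable_continuous.
pose psi := affine c s.
have cpsi := @continuous_affine c s.
have dE : partial j (fun x => psi x * phi x) =
    (fun x => psi x * partial j phi x + s 0 j * phi x).
  apply/funext => x; rewrite [LHS](@deriveM _ _ psi phi).
  - by rewrite [X in _ + _ *: X]partial_affine [X in _ + X = _]mulrC.
  - exact/diff_derivable/differentiable_affine.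
  - exact/diff_derivable.
have c1 : continuous (fun x => psi x * partial j phi x).
  by move=> x; apply: (@continuousM _ V psi); [exact: cpsi|exact: cphi1].
have c2 : continuous (fun x => s 0 j * phi x).
  by move=> x; apply: (@continuousM _ V (cst _)); [exact: cst_continuous|exact: cphi0].
have i1 := @continuous_compact_support_integrable _ _ _ C c1 cphi.
have i2 := @continuous_compact_support_integrable _ _ _ C c2 cphi.
have {}i1 : mu.-integrable setT (EFin \o (fun x : T => psi x * partial j phi x)).
  by apply: i1 => x /phi0' ->; rewrite mulr0.
have {}i2 : mu.-integrable setT (EFin \o (fun x : T => s 0 j * phi x)).
  by apply: i2 => x /phi0 ->; rewrite mulr0.
apply/eqP; rewrite -addr_eq0 -RintegralD//; last 2 first.
- exact: integrableS i1.
- exact: integrableS i2.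
(* Extending the integrand by 0 to the whole space changes nothing, since the support of [phi] lies
   in [Omega]. *)
rewrite Rintegral_mkcond; apply/eqP.
rewrite -(@Rintegral_partial_eq0 _ _ (fun x => psi x * phi x) C j) => //.
- rewrite dE; apply: eq_Rintegral => x _; rewrite /patch; case: ifPn => // /negP xO.
  have Cx : ~ C x by move=> Cx; apply: xO; rewrite inE; exact: phiO.
  by rewrite phi0// phi0'// !mulr0 addr0.
- by move=> x; apply: differentiableM => //; exact: differentiable_affine.
- by rewrite dE => x; apply: (@continuousD _ _ V (fun x => psi x * partial j phi x) (fun x => s 0 j * phi x) x (c1 x) (c2 x)).
- by move=> x /phi0 ->; rewrite mulr0.
Qed.

(** Makes the products in the weak formulation integrable, so that the integral of a sum may be
    split. *)
Lemma test_function_sq_integrable (phi : V -> R) (j : 'I_n.+1) :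
  test_function Omega phi ->
  sq_integrable mu (Omega : set T) phi /\
  sq_integrable mu (Omega : set T) (partial j phi).
Proof.
move=> [sphi cphi phiO]; set C := closure _ in cphi phiO.
have clC : closed C := compact_closed (@norm_hausdorff _ _) cphi.
have phi0 x : ~ C x -> phi x = 0 := @eq0_outside_support phi x.
have c0 : continuous phi.
  by move=> x; apply/differentiable_continuous/(sphi [::] x).
have c1 : continuous (partial j phi).
  by move=> x; apply/differentiable_continuous/(sphi [:: j] x).
have [M _ phiM] := continuous_compact_support_bounded c0 cphi phi0.
have [N _ phiN] := continuous_compact_support_bounded c1 cphi
  (fun x => partial_eq0_outside j clC phi0).
split.
  apply: (@sq_integrable_bounded _ T _ _ _ mO finO _ M) => [|x _]; last exact: phiM.
  exact/measurable_funTS/continuous_measurable_Rn.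
apply: (@sq_integrable_bounded _ T _ _ _ mO finO _ N) => [|x _]; last exact: phiN.
exact/measurable_funTS/continuous_measurable_Rn.
Qed.

Lemma W12_add_affine (f : V -> R) (g : V -> 'rV[R]_n.+1) (c : R) (s : 'rV[R]_n.+1) :
  W12 Omega f g -> W12 Omega (fun x => f x + affine c s x) (fun x => g x + s).
Proof.
move=> [/L2P Lf Dg].
have /L2P La := L2_affine c s.
have Lc j := @sq_integrable_cst _ T _ mu _ mO finO (s 0 j).
have sE j : (fun x => (g x + s) 0 j) = (fun x => g x 0 j + s 0 j).
  by apply/funext => x; rewrite mxE.
split; first by apply/L2P; exact: sq_integrableD.
move=> j; have [/L2P Lg wg] := Dg j; rewrite sE; split.
  by apply/L2P; exact: sq_integrableD.
move=> phi tphi; have [s0 s1] := test_function_sq_integrable j tphi.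
under eq_Rintegral do rewrite mulrDl.
under [in RHS]eq_Rintegral do rewrite mulrDl.
rewrite !RintegralD//; [|exact: sq_integrableM..].
by rewrite wg// weak_partial_affine// opprD.
Qed.

End sobolev_affine.

(** * Inequalities for the squared Frobenius norm *)

Section frobenius.
Context (R : realType).

Definition sqnorm (m p : nat) (A : 'M[R]_(m, p)) : R :=
  \sum_i \sum_j A i j ^+ 2.

Lemma sqnorm_ge0 (m p : nat) (A : 'M[R]_(m, p)) : 0 <= sqnorm A.
Proof. by apply: sumr_ge0 => i _; apply: sumr_ge0 => j _; exact: sqr_ge0. Qed.

Lemma sqr_enorm (m p : nat) (A : 'M[R]_(m, p)) : enorm A ^+ 2 = sqnorm A.
Proof. by rewrite sqr_sqrtr// sqnorm_ge0. Qed.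

Lemma sqnorm_le_entrywise (m p : nat) (A B C : 'M[R]_(m, p))
    (a b : R) :
  (forall i j, A i j ^+ 2 <= a * B i j ^+ 2 + b * C i j ^+ 2) ->
  sqnorm A <= a * sqnorm B + b * sqnorm C.
Proof.
move=> ABC; rewrite /sqnorm !mulr_sumr -big_split /=.
apply: ler_sum => i _; rewrite !mulr_sumr -big_split /=.
by apply: ler_sum => j _; exact: ABC.
Qed.

(** Weighted Young inequality: entrywise the gap between the two sides is the square of [c * a + b]
    divided by [c]. *)
Lemma sqnormB_le (m p : nat) (A B : 'M[R]_(m, p)) (c : R) : 0 < c ->
  sqnorm (A - B) <= (1 + c) * sqnorm A + (1 + c^-1) * sqnorm B.
Proof.
move=> c0; apply: sqnorm_le_entrywise => // i j; rewrite !mxE.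
set a := A i j; set b := B i j.
rewrite -subr_ge0 (_ : _ - _ = (c * a + b) ^+ 2 / c); last by field; rewrite gt_eqF.
by rewrite divr_ge0 ?sqr_ge0 ?ltW.
Qed.

Lemma sqnormD_le (m p : nat) (A B : 'M[R]_(m, p)) :
  sqnorm (A + B) <= 2 * sqnorm A + 2 * sqnorm B.
Proof.
apply: sqnorm_le_entrywise => // i j; rewrite !mxE.
by have := sqr_ge0 (A i j - B i j); nra.
Qed.

(** Cauchy-Schwarz, from Lagrange's identity for the double sum of
    [(a i * b j - a j * b i) ^+ 2]. *)
Lemma sqr_sum_le (I : finType) (a b : I -> R) :
  (\sum_i a i * b i) ^+ 2 <= (\sum_i a i ^+ 2) * (\sum_i b i ^+ 2).
Proof.
have : 0 <= \sum_i \sum_j (a i * b j - a j * b i) ^+ 2.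
  by apply: sumr_ge0 => i _; apply: sumr_ge0 => j _; exact: sqr_ge0.
set X := \sum_i a i * b i; set A := \sum_i a i ^+ 2; set B := \sum_i b i ^+ 2.
suff -> : \sum_i \sum_j (a i * b j - a j * b i) ^+ 2 = 2 * (A * B - X ^+ 2).
  by lra.
transitivity (\sum_i (a i ^+ 2 * B + b i ^+ 2 * A - 2 * (a i * b i) * X)).
  apply: eq_bigr => i _; rewrite /B /A /X !mulr_sumr -sumrN -!big_split /=.
  by apply: eq_bigr => j _; ring.
rewrite !big_split /= sumrN -!mulr_suml -mulr_sumr -/A -/B -/X; ring.
Qed.

Lemma sqnorm_mulmx_le (m p q : nat) (A : 'M[R]_(m, p)) (B : 'M[R]_(p, q)) :
  sqnorm (A *m B) <= sqnorm A * sqnorm B.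
Proof.
rewrite {1}/sqnorm mulr_suml; apply: ler_sum => i _.
rewrite [sqnorm B]exchange_big mulr_sumr; apply: ler_sum => j _ /=.
by rewrite mxE; exact: sqr_sum_le.
Qed.

(** Taking the skew part is a contraction: a matrix and its transpose have the same norm, and the
    square of a half-difference is at most the mean of the squares. *)
Lemma sqnorm_skew_le (m : nat) (A : 'M[R]_m) : sqnorm (2^-1 *: (A - A^T)) <= sqnorm A.
Proof.
have -> : sqnorm A = 2^-1 * sqnorm A + 2^-1 * sqnorm A^T.
  rewrite (_ : sqnorm A^T = sqnorm A); first by lra.
  rewrite /sqnorm exchange_big; apply: eq_bigr => i _; apply: eq_bigr => j _.
  by rewrite mxE.
apply: sqnorm_le_entrywise => // i j; rewrite !mxE.
by have := sqr_ge0 (A i j + A j i); nra.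
Qed.

End frobenius.

Section diameter.
Context (R : realType) (n : nat).

Lemma sqnorm_le_diam (A : set 'cV[R]_n.+1) (x y : 'cV[R]_n.+1) :
  bounded_set A -> A x -> A y -> sqnorm (x - y) <= diam A ^+ 2.
Proof.
move=> bA Ax Ay; rewrite -sqr_enorm.
suff : enorm (x - y) <= diam A.
  by move=> le; rewrite lerXn2r ?nnegrE ?sqrtr_ge0// (le_trans _ le)// sqrtr_ge0.
(* A real [sup] dominates its set only when that set is bounded above. Here two points of an
   enclosing box differ by at most [2 * N] in each coordinate. *)
apply: ub_le_sup; last by exists x, y.
have [N N0 AN] := bounded_sub_box bA.
exists (Num.sqrt (\sum_(i < n.+1) \sum_(j < 1) (2 * N) ^+ 2)) => _ [p [q [Ap Aq ->]]].
apply: ler_wsqrtr; apply: ler_sum => i _; apply: ler_sum => j _; rewrite !mxE ord1.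
by have := AN _ Ap i; have := AN _ Aq i; rewrite !mxE; nra.
Qed.

End diameter.

(** * Averages over a set of finite positive measure *)

Section averages.
Context (R : realType) (n : nat).
Local Notation V := 'cV[R]_n.+1.
Local Notation T := (lebesgue_Rn R n).
Local Notation mu := (leb R n).
Context (E : set T).
Hypotheses (mE : measurable E) (finE : (mu E < +oo)%E) (E_gt0 : 0 < fine (mu E)).

Local Notation sqi := (@sq_integrable _ T R mu E).

Lemma avgB (f g : T -> R) : sqi f -> sqi g ->
  avg E (fun x => f x - g x) = avg E f - avg E g.
Proof.
move=> sf sg; rewrite /avg RintegralB// ?mulrBr//; exact: sq_integrable_integrable.
Qed.

Lemma avg_cst (c : R) : avg E (fun=> c) = c.
Proof. by rewrite /avg Rintegral_cst// mulrCA mulVf ?mulr1// gt_eqF. Qed.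

Lemma avg_mulmx (m p : nat) (A : 'M[R]_(m, p)) (f : T -> 'cV[R]_p) :
  (forall k, sqi (fun x => f x k 0)) ->
  avg_mx E (fun x => A *m f x) = A *m avg_mx E f.
Proof.
move=> sf; apply/matrixP => i j; rewrite !mxE ord1 /avg.
under eq_Rintegral do rewrite mxE.
have sA k := sq_integrable_integrable mE finE (sq_integrableZ mE (A i k) (sf k)).
rewrite (Rintegral_sum mE finE sA).2 mulr_sumr; apply: eq_bigr => k _.
rewrite RintegralZl//; last exact: sq_integrable_integrable.
by rewrite mxE mulrCA.
Qed.

(** Jensen's inequality applied to each entry and summed. *)
Lemma sqnorm_avg_le (m p : nat) (f : T -> 'M[R]_(m, p)) :
  (forall i j, sqi (fun x => f x i j)) ->
  fine (mu E) * sqnorm (avg_mx E f) <= \int[mu]_(x in E) sqnorm (f x).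
Proof.
move=> sf; rewrite /sqnorm.
have i1 i := Rintegral_sum mE finE (fun j => (sf i j).2).
rewrite (Rintegral_sum mE finE (fun i => (i1 i).1)).2 mulr_sumr.
apply: ler_sum => i _; rewrite (i1 i).2 mulr_sumr; apply: ler_sum => j _.
by rewrite mxE; exact: sq_Rintegral_le.
Qed.

Lemma skew_avgE (G : T -> 'M[R]_n.+1) : (forall i j, sqi (fun x => G x i j)) ->
  skew_avg E G = 2^-1 *: (avg_mx E G - (avg_mx E G)^T).
Proof.
move=> sG; rewrite /skew_avg; congr (_ *: _); apply/matrixP => i j; rewrite !mxE.
rewrite -avgB//; congr avg; apply/funext => x; by rewrite !mxE.
Qed.

(** The barycenter may lie outside [Omega], so the diameter does not apply to it directly. Instead
    [x - barycenter E] is the average over [y] in [E] of [x - y], and Jensen's inequality transfers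
    the bound on each [x - y]. *)
Lemma sqnorm_sub_barycenter_le (Omega : set V) (x : V) :
  (forall i, sqi (fun y : V => y i 0)) -> bounded_set Omega -> E `<=` Omega ->
  Omega x -> sqnorm (x - barycenter E) <= diam Omega ^+ 2.
Proof.
move=> sc bO EO Ox.
have sx i (j : 'I_1) : sqi (fun y : V => (x - y) i j).
  have := sq_integrableB mE (sq_integrable_cst mE finE (x i 0)) (sc i).
  by congr sq_integrable; apply/funext => y; rewrite !mxE ord1.
have -> : x - barycenter E = avg_mx E (fun y : V => x - y).
  apply/matrixP => i j; rewrite !mxE ord1.
  have := avgB (sq_integrable_cst mE finE (x i 0)) (sc i).
  rewrite avg_cst// => <-.
  by congr avg; apply/funext => y; rewrite !mxE.
rewrite -(ler_pM2l E_gt0); apply: le_trans (sqnorm_avg_le sx) _.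
rewrite mulrC -Rintegral_cst//; apply: le_Rintegral => //.
- exact: (Rintegral_sum mE finE (fun i => (Rintegral_sum mE finE (fun j => (sx i j).2)).1)).1.
- exact: integrable_cst_fin.
- by move=> y Ey; exact: sqnorm_le_diam (EO _ Ey).
Qed.

End averages.

Lemma le_sqr_of_sqrt (R : rcfType) (a b c : R) : 0 <= a -> 0 <= c -> 0 <= b ->
  Num.sqrt a <= c * Num.sqrt b -> a <= c ^+ 2 * b.
Proof.
move=> a0 c0 b0 le; rewrite -(sqr_sqrtr a0) -(sqr_sqrtr b0) -exprMn.
by rewrite lerXn2r ?nnegrE ?mulr_ge0 ?sqrtr_ge0.
Qed.

(** * The extended-real norms as square roots of real integrals *)

Section norms.
Context (R : realType) (n : nat) (Omega : set 'cV[R]_n.+1).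
Hypotheses (Omega_open : open Omega).
Local Notation V := 'cV[R]_n.+1.
Local Notation T := (lebesgue_Rn R n).
Local Notation mu := (leb R n).
Let mO : measurable (Omega : set T) := open_measurable_Rn Omega_open.

Lemma poweR_half_Rintegral (f : V -> R) : (forall x, 0 <= f x) ->
  mu.-integrable (Omega : set T) (EFin \o f : T -> \bar R) ->
  ((\int[mu]_(x in Omega) (f x)%:E) `^ 2^-1 =
   (Num.sqrt (\int[mu]_(x in Omega) f x))%:E)%E.
Proof.
move=> f0 intf; rewrite -powR12_sqrt; last exact: Rintegral_ge0.
by rewrite -poweR_EFin fineK//; exact: integrable_fin_num intf.
Qed.

Lemma L2normE (f : V -> R) :
  mu.-integrable (Omega : set T) (EFin \o (fun x => f x ^+ 2) : T -> \bar R) ->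
  L2norm Omega f = (Num.sqrt (\int[mu]_(x in Omega) (f x ^+ 2)))%:E.
Proof.
move=> intf; rewrite -poweR_half_Rintegral//; last by move=> x; exact: sqr_ge0.
rewrite /L2norm Lnorm.unlock [in RHS]integral_mkcond; congr (_ `^ _)%E.
apply: eq_integral => x _.
rewrite /= /patch; case: (x \in _) => /=; last by rewrite [point]/(0 : R) normr0 powR0.
by rewrite powR_mulrn// real_normK// num_real.
Qed.

Lemma L2norm_mxE (m p : nat) (F : V -> 'M[R]_(m, p)) :
  mu.-integrable (Omega : set T) (EFin \o (fun x => sqnorm (F x)) : T -> \bar R) ->
  L2norm_mx Omega F = (Num.sqrt (\int[mu]_(x in Omega) sqnorm (F x)))%:E.
Proof.
have FE : (fun x => sqnorm (F x)) = (fun x => enorm (F x) ^+ 2).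
  by apply/funext => x; rewrite sqr_enorm.
by rewrite FE => intF; rewrite /L2norm_mx L2normE.
Qed.

Lemma W12normE (u : V -> V) (Du : V -> 'M[R]_n.+1) :
  mu.-integrable (Omega : set T)
    (EFin \o (fun x => sqnorm (u x) + sqnorm (Du x)) : T -> \bar R) ->
  W12norm Omega u Du =
  (Num.sqrt (\int[mu]_(x in Omega) (sqnorm (u x) + sqnorm (Du x))))%:E.
Proof.
move=> intu; rewrite -poweR_half_Rintegral//; last first.
  by move=> x; rewrite addr_ge0 ?sqnorm_ge0.
by rewrite /W12norm; under eq_integral do rewrite !sqr_enorm.
Qed.

End norms.

(** * Korn and Poincare on [Omega], and the comparison with the normalisation over [E] *)

Theorem mainTheorem4 (R : realType) (n : nat) (Omega E : set 'cV[R]_n.+1)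
    (Q K : R)
    (Omega_open : open Omega) (Omega_connected : connected Omega)
    (Omega_bounded : bounded_set Omega)
    (Omega_lipschitz : lipschitz_boundary Omega)
    (E_measurable : measurable (E : set (lebesgue_Rn R n)))
    (E_sub : E `<=` Omega)
    (E_gt0 : (0 < leb R n E)%E)
    (Q_gt0 : 0 < Q)
    (poincare : forall (f : 'cV[R]_n.+1 -> R) (Df : 'cV[R]_n.+1 -> 'rV[R]_n.+1),
       W12 Omega f Df ->
       (L2norm Omega (fun x => (f x - avg Omega f)%R) <=
        Q%:E * L2norm_mx Omega Df)%E)
    (K_gt0 : 0 < K)
    (korn : forall (u : 'cV[R]_n.+1 -> 'cV[R]_n.+1)
                   (Du : 'cV[R]_n.+1 -> 'M[R]_n.+1),
       W12_vec Omega u Du ->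
       (L2norm_mx Omega (fun x => (Du x - skew_avg Omega Du)%R) <=
        K%:E * L2norm_mx Omega (fun x => sym_part (Du x)))%E)
    (u : 'cV[R]_n.+1 -> 'cV[R]_n.+1) (Du : 'cV[R]_n.+1 -> 'M[R]_n.+1)
    (u_W12 : W12_vec Omega u Du) :
  let w := fun x : 'cV[R]_n.+1 =>
    u x - avg_mx E u - skew_avg E Du *m (x - barycenter E) in
  exists2 Dw : 'cV[R]_n.+1 -> 'M[R]_n.+1,
    W12_vec Omega w Dw &
    (W12norm Omega w Dw <=
     ((1 + Num.sqrt (2 * (fine (leb R n Omega) / fine (leb R n E)) *
                     (1 + diam Omega ^+ 2))) *
      K * Num.sqrt (1 + Q ^+ 2))%:E *
     L2norm_mx Omega (fun x => sym_part (Du x)))%E.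
Proof.
move=> w.
pose T := lebesgue_Rn R n; pose mu := leb R n.
have mO : measurable (Omega : set T) := open_measurable_Rn Omega_open.
have finO : (mu Omega < +oo)%E := bounded_leb_lty Omega_bounded.
have finE : (mu E < +oo)%E := le_lt_trans (le_lebesgue_outer E_sub) finO.
have fE0 : 0 < fine (mu E) by rewrite fine_gt0// E_gt0.
have fO0 : 0 < fine (mu Omega).
  by rewrite fine_gt0// finO andbT (lt_le_trans E_gt0)// le_lebesgue_outer.
pose sqi := sq_integrable mu (Omega : set T).
have sqi_eq f g : sqi f -> f =1 g -> sqi g by move=> + /funext <-.
have sqiE f : sqi f -> sq_integrable mu (E : set T) f by exact: sq_integrableS.
have su i : sqi (fun x => u x i 0) by apply/L2P => //; case: (u_W12 i).
have sDu i j : sqi (fun x => Du x i j).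
  have [_ /(_ j)[/(L2P Omega_open) + _]] := u_W12 i.
  by move/sqi_eq; apply => x; rewrite mxE.
have sx i : sqi (fun x : 'cV[R]_n.+1 => x i 0).
  have /(L2P Omega_open) :=
    L2_affine Omega_open Omega_bounded 0 (delta_mx 0 i).
  by move/sqi_eq; apply => x; rewrite /affine -rowE add0r !mxE.
have scst c : sqi (fun=> c) by exact: sq_integrable_cst.
have sq_mx m p (F : 'cV[R]_n.+1 -> 'M[R]_(m, p)) :
    (forall i j, sqi (fun x => F x i j)) ->
    mu.-integrable (Omega : set T) (EFin \o (fun x => sqnorm (F x)) : T -> \bar R).
  move=> sF.
  exact: (Rintegral_sum mO finO (fun i => (Rintegral_sum mO finO (fun j => (sF i j).2)).1)).1.
(* Both [z] below and [w] are of this form; for [w] the constant [a] absorbs the image of the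
   barycenter. *)
have u_affine (a : 'cV[R]_n.+1) (M : 'M[R]_n.+1) :
    W12_vec Omega (fun x => u x - a - M *m x) (fun x => Du x - M).
  move=> i.
  have := W12_add_affine Omega_open Omega_bounded (- a i 0) (- row i M) (u_W12 i).
  congr W12; apply/funext => x; last by rewrite linearB.
  by rewrite /affine mulNmx -row_mul !mxE addrA.
pose A := skew_avg Omega Du; pose B := skew_avg E Du.
(* The subtracted 0 makes [z] literally an instance of [u_affine]. Subtracting its average over
   [Omega] yields [v], to which Poincare applies, while Korn bounds the gradient [Dv]. *)
pose z (x : 'cV[R]_n.+1) := u x - 0 - A *m x.
pose v x := z x - avg_mx Omega z.
pose Dv x := Du x - A.
have sDM (M : 'M[R]_n.+1) i j : sqi (fun x => (Du x - M) i j).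
  have := sq_integrableB mO (sDu i j) (scst (M i j)).
  by move/sqi_eq; apply => x; rewrite !mxE.
have sz i : sqi (fun x => z x i 0).
  by apply/L2P => //; case: (u_affine 0 A i).
have sv i j : sqi (fun x => v x i j).
  have := sq_integrableB mO (sz i) (scst (avg_mx Omega z i 0)).
  by move/sqi_eq; apply => x; rewrite !mxE ord1.
have iv := sq_mx _ _ _ sv.
have iDv := sq_mx _ _ _ (sDM A).
pose kappa := \int[mu]_(x in Omega) sqnorm (sym_part (Du x)).
have kappa0 : 0 <= kappa by apply: Rintegral_ge0 => x _; exact: sqnorm_ge0.
have isym : mu.-integrable (Omega : set T)
    (EFin \o (fun x => sqnorm (sym_part (Du x))) : T -> \bar R).
  apply: sq_mx => i j.
  have := sq_integrableZ mO 2^-1 (sq_integrableD mO (sDu i j) (sDu j i)).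
  by move/sqi_eq; apply => x; rewrite !mxE.
have kornR : \int[mu]_(x in Omega) sqnorm (Dv x) <= K ^+ 2 * kappa.
  have := korn _ _ u_W12; rewrite !L2norm_mxE// -EFinM lee_fin -/kappa.
  apply: le_sqr_of_sqrt (ltW K_gt0) _ => //.
  by apply: Rintegral_ge0 => x _; exact: sqnorm_ge0.
have irow i : mu.-integrable (Omega : set T)
    (EFin \o (fun x => sqnorm (row i (Dv x))) : T -> \bar R).
  apply: sq_mx => k j; have := sDM A i j.
  by move/sqi_eq; apply => x; rewrite !mxE.
(* Poincare is a scalar hypothesis, so it is used on each component of [z], whose gradient is the
   corresponding row of [Dv]; the rows are summed afterwards. *)
have poincare_row i : \int[mu]_(x in Omega) (v x i 0 ^+ 2) <=
    Q ^+ 2 * \int[mu]_(x in Omega) sqnorm (row i (Dv x)).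
  have := poincare _ _ (u_affine 0 A i).
  have -> : (fun x => (u x - 0 - A *m x) i 0 -
      avg Omega (fun x => (u x - 0 - A *m x) i 0)) = (fun x => v x i 0).
    apply/funext => x; rewrite [RHS]mxE; congr (_ + _).
    by rewrite [RHS]mxE [avg_mx _ _ _ _]mxE.
  rewrite L2normE//; last exact: (sv i 0).2.
  rewrite L2norm_mxE// -EFinM lee_fin.
  apply: le_sqr_of_sqrt (ltW Q_gt0) _; apply: Rintegral_ge0 => x _.
    exact: sqr_ge0.
  exact: sqnorm_ge0.
have poincareR : \int[mu]_(x in Omega) sqnorm (v x) <=
    Q ^+ 2 * \int[mu]_(x in Omega) sqnorm (Dv x).
  have -> : \int[mu]_(x in Omega) sqnorm (v x) =
      \sum_i \int[mu]_(x in Omega) (v x i 0 ^+ 2).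
    rewrite -(Rintegral_sum mO finO (fun i => (sv i 0).2)).2.
    by apply: eq_Rintegral => x _; apply: eq_bigr => i _; rewrite big_ord1.
  have -> : \int[mu]_(x in Omega) sqnorm (Dv x) =
      \sum_i \int[mu]_(x in Omega) sqnorm (row i (Dv x)).
    rewrite -(Rintegral_sum mO finO irow).2.
    apply: eq_Rintegral => x _; apply: eq_bigr => i _; rewrite /sqnorm big_ord1.
    by apply: eq_bigr => j _; rewrite [row _ _ _ _]mxE.
  by rewrite mulr_sumr; apply: ler_sum.
pose P := \int[mu]_(x in Omega) (sqnorm (v x) + sqnorm (Dv x)).
have iP : mu.-integrable (Omega : set T)
    (EFin \o (fun x => sqnorm (v x) + sqnorm (Dv x)) : T -> \bar R).
  exact: (integrableD mO iv iDv).
have P0 : 0 <= P by apply: Rintegral_ge0 => x _; rewrite addr_ge0 ?sqnorm_ge0.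
have PE : P = \int[mu]_(x in Omega) sqnorm (v x) + \int[mu]_(x in Omega) sqnorm (Dv x).
  exact: RintegralD.
have Pkappa : P <= (1 + Q ^+ 2) * K ^+ 2 * kappa.
  rewrite PE; apply: le_trans (_ : (1 + Q ^+ 2) * \int[mu]_(x in Omega) sqnorm (Dv x) <= _).
    by rewrite mulrDl mul1r addrC lerD2l.
  by rewrite -mulrA ler_wpM2l// addr_ge0// sqr_ge0.
(* A constant skew matrix is its own skew average, which is why subtracting [A] from the gradient
   shifts the skew average over [E] by exactly [A] in [SE]. *)
have A_skew : A^T = - A.
  rewrite /A skew_avgE// -linearN /=; apply/matrixP => i j; rewrite !mxE; ring.
clearbody A.
pose S := skew_avg E Dv; pose vE := avg_mx E v.
have sEv i j := sqiE _ (sv i j).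
have sEDv i j := sqiE _ (sDM A i j).
have sEDu i j := sqiE _ (sDu i j).
have sEcst c := sqiE _ (scst c).
have SE : S = B - A.
  rewrite /S /B (skew_avgE E_measurable finE sEDu).
  rewrite (skew_avgE E_measurable finE sEDv).
  have -> : avg_mx E Dv = avg_mx E Du - A.
    apply/matrixP => i j; rewrite !mxE -[in RHS](avg_cst E_measurable fE0 (A i j)).
    rewrite -(avgB E_measurable finE (sEDu i j) (sEcst (A i j))).
    by congr avg; apply/funext => x; rewrite !mxE.
  apply/matrixP => i j; have := congr1 (fun M : 'M[R]_n.+1 => M i j) A_skew.
  by rewrite !mxE => ->; field.
have vEE : vE = avg_mx E u - A *m barycenter E - avg_mx Omega z.
  (* The linear map given by [A] is recovered as [u - z], so its square integrability is
     inherited. *)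
  have sA i : sqi (fun x : 'cV[R]_n.+1 => (A *m x) i 0).
    have := sq_integrableB mO (su i) (sz i).
    by move/sqi_eq; apply => x; rewrite !mxE; ring.
  rewrite /barycenter -(avg_mulmx E_measurable finE A (fun k => sqiE _ (sx k))).
  apply/matrixP => i j; rewrite ord1 [vE i 0]mxE.
  rewrite !mxE; set a := avg Omega _; rewrite -[a](avg_cst E_measurable fE0).
  have suA := sq_integrableB E_measurable (sqiE _ (su i)) (sqiE _ (sA i)).
  rewrite -(avgB E_measurable finE (sqiE _ (su i)) (sqiE _ (sA i))).
  rewrite -(avgB E_measurable finE suA (sEcst a)).
  by congr avg; apply/funext => x; rewrite !mxE subr0.
pose r (x : 'cV[R]_n.+1) := vE + S *m (x - barycenter E).
(* The average of [z] over [Omega] and all terms in [A] cancel: normalising [u] or [v] over [E]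
   gives the same function. *)
have wE x : w x = v x - r x.
  rewrite /w /r vEE SE /v /z mulmxBl !mulmxBr -/B subr0.
  apply/matrixP => i j; rewrite !mxE; ring.
have DwE x : Du x - B = Dv x - S by rewrite SE /Dv opprB addrA subrK.
exists (fun x => Du x - B).
  have := u_affine (avg_mx E u - B *m barycenter E) B; congr W12_vec.
  apply/funext => x; rewrite /w mulmxBr -/B; apply/matrixP => i j; rewrite !mxE; ring.
set d2 := diam Omega ^+ 2.
(* The square of the second constant in the claim. The factor [2 * (1 + d2)] comes from the
   pointwise bound on the affine correction [r], and the ratio of measures from integrating over
   [Omega] a constant that is controlled by averages over [E]. *)
pose q := 2 * (fine (mu Omega) / fine (mu E)) * (1 + d2).
have d20 : 0 <= d2 by exact: sqr_ge0.
have q0 : 0 < q by rewrite !mulr_gt0 ?invr_gt0// ltr_wpDr.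
rewrite -/q; set c := Num.sqrt q.
have c0 : 0 < c by rewrite sqrtr_gt0.
have cq : c ^+ 2 = q by rewrite sqr_sqrtr// ltW.
have sw i j : sqi (fun x => w x i j).
  rewrite ord1; apply/L2P => //.
  have := u_affine (avg_mx E u - B *m barycenter E) B i; case=> + _.
  congr L2; apply/funext => x; rewrite /w mulmxBr -/B !mxE; ring.
have iw : mu.-integrable (Omega : set T)
    (EFin \o (fun x => sqnorm (w x) + sqnorm (Du x - B)) : T -> \bar R).
  exact: (integrableD mO (sq_mx _ _ _ sw) (sq_mx _ _ _ (sDM B))).
rewrite W12normE// L2norm_mxE// -EFinM lee_fin -/kappa.
(* Jensen's inequality on [E] bounds the averages of [v] and [Dv], passing to the skew part does not
   increase the norm, and enlarging [E] to [Omega] only increases the integrals. *)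
have le_const : fine (mu E) * (sqnorm vE + sqnorm S) <= P.
  have SM : sqnorm S <= sqnorm (avg_mx E Dv).
    by rewrite /S skew_avgE//; exact: sqnorm_skew_le.
  have iEv := integrableS mO E_measurable E_sub iv.
  have iEDv := integrableS mO E_measurable E_sub iDv.
  have subE (f : 'cV[R]_n.+1 -> R) : (forall x, 0 <= f x) ->
      mu.-integrable (Omega : set T) (EFin \o f : T -> \bar R) ->
      \int[mu]_(x in E) f x <= \int[mu]_(x in Omega) f x.
    move=> f0 intf; apply: fine_le.
    - exact: integrable_fin_num (integrableS mO E_measurable E_sub intf).
    - exact: integrable_fin_num intf.
    - have [mf _] := integrableP _ _ _ intf.
      have fe x : Omega x -> (0 <= (EFin \o f) x)%E by move=> _; rewrite lee_fin.
      exact: (ge0_subset_integral mu E_measurable mO mf fe E_sub).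
  rewrite PE mulrDr lerD//.
    apply: le_trans (subE _ _ iv) => [|x]; last exact: sqnorm_ge0.
    exact: sqnorm_avg_le.
  apply: le_trans (subE _ _ iDv) => [|x]; last exact: sqnorm_ge0.
  apply: le_trans (sqnorm_avg_le E_measurable finE fE0 sEDv).
  by rewrite ler_pM2l.
(* The left side is at most twice [sqnorm vE] plus [2 * d2 + 1] times [sqnorm S]. The bound is
   uniform in [x], so its integral over [Omega] is just a multiple of the measure of [Omega]. *)
have rle x : Omega x -> sqnorm (r x) + sqnorm S <=
    2 * (1 + d2) * (sqnorm vE + sqnorm S).
  move=> Ox.
  have xd : sqnorm (x - barycenter E) <= d2.
    exact: (sqnorm_sub_barycenter_le E_measurable finE fE0
      (fun i => sqiE _ (sx i)) Omega_bounded E_sub Ox).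
  have := sqnormD_le vE (S *m (x - barycenter E)).
  have := sqnorm_mulmx_le S (x - barycenter E).
  have := ler_wpM2l (sqnorm_ge0 S) xd.
  have := mulr_ge0 (sqnorm_ge0 vE) d20.
  have := sqnorm_ge0 S; rewrite -/(r x); lra.
(* Weighted Young with weight [c] replaces Minkowski: the remainder is at most
   [c ^+ 2 * P], and [(1 + c) * P + (1 + c^-1) * c ^+ 2 * P = (1 + c) ^+ 2 * P]. *)
have W_le : \int[mu]_(x in Omega) (sqnorm (w x) + sqnorm (Du x - B)) <= (1 + c) ^+ 2 * P.
  have ci0 : 0 <= 1 + c^-1 by rewrite addr_ge0// invr_ge0 ltW.
  pose m := 2 * (1 + d2) * (sqnorm vE + sqnorm S).
  have iPc : mu.-integrable (Omega : set T)
      (EFin \o (fun x => (1 + c) * (sqnorm (v x) + sqnorm (Dv x))) : T -> \bar R).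
    exact: (integrableZl mO (1 + c) iP).
  apply: le_trans (_ : \int[mu]_(x in Omega)
    ((1 + c) * (sqnorm (v x) + sqnorm (Dv x)) + (1 + c^-1) * m) <= _).
    apply: le_Rintegral => //.
      exact: (integrableD mO iPc (integrable_cst_fin mO finO _)).
    move=> x Ox; rewrite wE DwE.
    have := sqnormB_le (v x) (r x) c0; have := sqnormB_le (Dv x) S c0.
    have := ler_wpM2l ci0 (rle x Ox); rewrite -/m; lra.
  rewrite RintegralD//; last exact: integrable_cst_fin.
  rewrite RintegralZl// Rintegral_cst// -/P.
  (* Rewriting the measure of [Omega] as a ratio times that of [E] brings in the quantity bounded by
     [P] in [le_const]. *)
  have mq : m * fine (mu Omega) = q * (fine (mu E) * (sqnorm vE + sqnorm S)).
    by rewrite /m /q; field; rewrite gt_eqF.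
  rewrite -mulrA mq -cq (_ : (1 + c) ^+ 2 * P = (1 + c) * P + (1 + c^-1) * (c ^+ 2 * P)).
    by rewrite lerD2l (ler_wpM2l ci0)// ler_wpM2l// sqr_ge0.
  by field; rewrite gt_eqF.
(* The constant is gathered under one square root, so that the claim follows from the squared
   estimates by monotonicity. *)
have -> : (1 + c) * K * Num.sqrt (1 + Q ^+ 2) * Num.sqrt kappa =
    Num.sqrt ((1 + c) ^+ 2 * ((1 + Q ^+ 2) * K ^+ 2 * kappa)).
  have Q1 : 0 <= 1 + Q ^+ 2 by rewrite addr_ge0 ?sqr_ge0.
  have cK0 : 0 <= (1 + c) * K by rewrite mulr_ge0 ?addr_ge0 ?ltW.
  rewrite (_ : _ ^+ 2 * _ = ((1 + c) * K) ^+ 2 * ((1 + Q ^+ 2) * kappa)); last by ring.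
  by rewrite (sqrtrM _ (sqr_ge0 _)) sqrtr_sqr (ger0_norm cK0) (sqrtrM _ Q1) mulrA.
apply: ler_wsqrtr; apply: le_trans W_le _.
by rewrite ler_wpM2l// sqr_ge0.
Qed.
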